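(* Let $X$ and $Y$ be $\sigma$-compact spaces such that $X$ is finite dimensional. If there exist a continuous linear map $T:C_p(X)\to C_p(Y)$ such that $T(C_p(X))$ is dense in $C_p(Y)$, and a number $p\in\mathbb{N}$ such that $|\mathrm{supp}_T(y)|\leq p$ for every $y\in Y$, then $$\dim Y\leq p\cdot \dim X+p+p!-1.$$
   Context: All topological spaces are Tychonoff (completely regular Hausdorff), and $\mathbb{N}=\{1,2,\dots\}$. $C_p(X)$ is the space of real-valued continuous functions on $X$ with the topology of pointwise convergence. Dimension means the covering dimension $\dim$. Every continuous linear functional $\phi$ on $C_p(X)$ has the form $\phi(f)=\sum_{k=1}^n a_k f(x_k)$ with distinct points $x_1,\dots,x_n\in X$ and nonzero reals $a_1,\dots,a_n$ (the zero functional corresponding to the empty sum); its support is $\mathrm{supp}(\phi)=\{x_1,\dots,x_n\}$. For a continuous linear $T:C_p(X)\to C_p(Y)$ and $y\in Y$, $\mathrm{supp}_T(y)$ denotes the support of the functional $f\mapsto T(f)(y)$ on $C_p(X)$. *)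

(* Defs.v *)
From HB Require Import structures.
From mathcomp Require Import all_boot all_order all_algebra.
From mathcomp Require Import all_classical all_reals all_analysis.

Set Implicit Arguments.
Unset Strict Implicit.
Unset Printing Implicit Defensive.

Import Order.TTheory GRing.Theory Num.Theory.
Import numFieldNormedType.Exports.

Local Open Scope classical_set_scope.
Local Open Scope card_scope.
Local Open Scope ring_scope.

Definition tychonoff_space (X : topologicalType) :=
  completely_regular_space X /\ hausdorff_space X.

Definition sigma_compact (X : topologicalType) :=
  exists K : nat -> set X, (forall n, compact (K n)) /\ \bigcup_n K n = setT.

(** Covering dimension of Tychonoff spaces, through finite functionally open
    covers. *)

Definition functionally_open (R : realType) (X : topologicalType)
    (U : set X) :=
  exists2 f : X -> R, continuous f & U = [set x | f x != 0].

Definition finite_fopen_cover (R : realType) (X : topologicalType)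
    (U : set (set X)) :=
  [/\ finite_set U, (forall A, U A -> functionally_open R A) &
      \bigcup_(A in U) A = setT].

Definition refines (X : Type) (V U : set (set X)) :=
  forall B, V B -> exists2 A, U A & B `<=` A.

(* The bound is shifted by one ([dim X < m] rather than [dim X <= m - 1]) to
   stay in [nat]: for [m = 0] it says that [X] is empty. *)
Definition covdim_lt (R : realType) (X : topologicalType) (m : nat) :=
  forall U : set (set X), finite_fopen_cover R U ->
  exists V : set (set X), [/\ finite_fopen_cover R V, refines V U &
    forall x, [set B | V B /\ B x] #<= `I_m].

(* With values in [{-1, 0, 1, ...}] or [+oo]; the empty space has dimension
   [-1]. *)
Definition covdim (R : realType) (X : topologicalType) : \bar int :=
  match pselect (exists m, `[< covdim_lt R X m >]) with
  | left h => ((ex_minn h)%:Z - 1)%:E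
  | right _ => +oo%E
  end.

Lemma covdim_ltW (R : realType) (X : topologicalType) (m n : nat) :
  (m <= n)%N -> covdim_lt R X m -> covdim_lt R X n.
Proof.
move=> mn Xm U /Xm[V [cV rV oV]]; exists V; split=> // x.
by apply: card_le_trans (oV x) _; rewrite card_le_II.
Qed.

Lemma covdim_leP (R : realType) (X : topologicalType) (m : nat) :
  (covdim R X <= (m%:Z - 1)%:E)%E <-> covdim_lt R X m.
Proof.
rewrite /covdim; case: pselect => [h|h].
  case: ex_minnP => k /asboolP Xk kmin; rewrite lee_fin lerD2r lez_nat.
  by split=> [/covdim_ltW|Xm]; [exact | exact/kmin/asboolP].
by rewrite leye_eq; split=> // Xm; case: h; exists m; apply/asboolP.
Qed.

(** The space [C_p(X)]. *)

Definition Cp (R : realType) (X : topologicalType) : Type := continuousType X R.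

Section Cp_structures.
Context {R : realType} {X : topologicalType}.

Definition Cp_fun (f : Cp R X) : {ptws X -> R} := Continuous.sort f.

HB.instance Definition _ := Choice.copy (Cp R X) (continuousType X R).
HB.instance Definition _ := Topological.copy (Cp R X) (initial_topology Cp_fun).

Implicit Types f g h : Cp R X.

Let mkCp (f : X -> R) (cf : continuous f) : Cp R X :=
  HB.pack f (isContinuous.Build _ _ f cf).

Let CpP f g : Continuous.sort f =1 Continuous.sort g -> f = g.
Proof. by move/continuousEP. Qed.

Let add_cts f g : continuous (fun x => Continuous.sort f x + Continuous.sort g x).
Proof. by move=> x; apply: cvgD; exact: cts_fun. Qed.

Let opp_cts f : continuous (fun x => - Continuous.sort f x).
Proof. by move=> x; apply: cvgN; exact: cts_fun. Qed.

Let zero_cts : continuous (fun _ : X => 0 : R).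
Proof. exact: cst_continuous. Qed.

Let scale_cts (a : R) f : continuous (fun x => a * Continuous.sort f x).
Proof. by move=> x; apply: cvgMr; exact: cts_fun. Qed.

Let addA : associative (fun f g => mkCp (@add_cts f g)).
Proof. by move=> f g h; apply: CpP => x /=; rewrite addrA. Qed.

Let addC : commutative (fun f g => mkCp (@add_cts f g)).
Proof. by move=> f g; apply: CpP => x /=; rewrite addrC. Qed.

Let add0 : left_id (mkCp zero_cts) (fun f g => mkCp (@add_cts f g)).
Proof. by move=> f; apply: CpP => x /=; rewrite add0r. Qed.

Let addN : left_inverse (mkCp zero_cts) (fun f => mkCp (@opp_cts f))
  (fun f g => mkCp (@add_cts f g)).
Proof. by move=> f; apply: CpP => x /=; rewrite addNr. Qed.

HB.instance Definition _ := GRing.isZmodule.Build (Cp R X) addA addC add0 addN.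

Let scaleA a b f :
  mkCp (@scale_cts a (mkCp (@scale_cts b f))) = mkCp (@scale_cts (a * b) f).
Proof. by apply: CpP => x /=; rewrite mulrA. Qed.

Let scale1 : left_id 1 (fun a f => mkCp (@scale_cts a f)).
Proof. by move=> f; apply: CpP => x /=; rewrite mul1r. Qed.

Let scaleDr : right_distributive (fun a f => mkCp (@scale_cts a f)) +%R.
Proof. by move=> a f g; apply: CpP => x /=; rewrite mulrDr. Qed.

Let scaleDl f :
  {morph (fun a => mkCp (@scale_cts a f)) : a b / a + b}.
Proof. by move=> a b; apply: CpP => x /=; rewrite mulrDl. Qed.

HB.instance Definition _ := GRing.Zmodule_isLmodule.Build R (Cp R X)
  scaleA scale1 scaleDr scaleDl.

Lemma Cp_funP f g : (forall x, Cp_fun f x = Cp_fun g x) -> f = g.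
Proof. exact: CpP. Qed.

Lemma Cp_fun_continuous f : continuous (Cp_fun f : X -> R).
Proof. exact: cts_fun. Qed.

Lemma Cp_fun_surj (f : X -> R) : continuous f ->
  exists g, forall x, Cp_fun g x = f x.
Proof. by move=> cf; exists (mkCp cf). Qed.

Lemma Cp_fun0 x : Cp_fun 0 x = 0. Proof. by []. Qed.
Lemma Cp_funD f g x : Cp_fun (f + g) x = Cp_fun f x + Cp_fun g x.
Proof. by []. Qed.
Lemma Cp_funN f x : Cp_fun (- f) x = - Cp_fun f x. Proof. by []. Qed.
Lemma Cp_funZ a f x : Cp_fun (a *: f) x = a * Cp_fun f x. Proof. by []. Qed.

End Cp_structures.

(** Supports. *)

Definition point_combination (R : realType) (X : topologicalType)
    (phi : Cp R X -> R) (n : nat) (x : 'I_n -> X) (a : 'I_n -> R) :=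
  [/\ injective x, (forall k, a k != 0) &
      forall f, phi f = \sum_(k < n) a k * Cp_fun f (x k)].

Definition supp (R : realType) (X : topologicalType)
    (phi : Cp R X -> R) : set X :=
  [set z | exists n (x : 'I_n -> X) (a : 'I_n -> R),
     point_combination phi x a /\ range x z].

Definition supp_at (R : realType) (X Y : topologicalType)
    (T : Cp R X -> Cp R Y) (y : Y) : set X :=
  supp (fun f => Cp_fun (T f) y).

Lemma tychonoff_bump (R : realType) (X : topologicalType) (s : seq X) (z : X) :
  tychonoff_space X -> exists e : Cp R X,
    Cp_fun e z = 1 /\ forall w, w \in s -> w != z -> Cp_fun e w = 0.
Proof.
move=> [crX hX]; pose B := [set w | w \in [seq w <- s | w != z]].
have clB : closed B.
  apply: (accessible_finite_set_closed.1 (hausdorff_accessible hX)).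
  exact: finite_seq.
have nBz : ~ B z by rewrite /B /= mem_filter eqxx.
have /(@uniform_separatorP _ R)[g [cg _ g0 g1]] := crX z B clB nBz.
have ch : continuous (fun x => 1 - g x).
  by move=> x; apply: cvgB; [exact: cvg_cst | exact: cg].
have [e eE] := Cp_fun_surj ch; exists e; split=> [|w sw wz]; rewrite eE.
  have -> : g z = 0 by apply: g0; exists z.
  by rewrite subr0.
have -> : g w = 1 by apply: g1; exists w => //; rewrite /B /= mem_filter wz.
by rewrite subrr.
Qed.

Lemma supp_rangeE (R : realType) (X : topologicalType) (phi : Cp R X -> R)
    (n : nat) (x : 'I_n -> X) (a : 'I_n -> R) :
  tychonoff_space X -> point_combination phi x a -> supp phi = range x.
Proof.
move=> tX xa; have [xi a0 phiE] := xa; rewrite eqEsubset; split; last first.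
  by move=> z xz; exists n, x, a.
move=> _ [m [y [b [[yi b0 phiE'] [k _ <-]]]]]; apply: contrapT => nx.
have [e [e1 e0]] := @tychonoff_bump R X
  ([seq x i | i <- enum 'I_n] ++ [seq y i | i <- enum 'I_m]) (y k) tX.
have : phi e = 0.
  rewrite phiE big1// => i _; have -> : Cp_fun e (x i) = 0; last exact: mulr0.
  apply: e0; first by rewrite mem_cat map_f ?mem_enum.
  by apply/eqP => xy; apply: nx; exists i.
have rest0 : \sum_(i < m | i != k) b i * Cp_fun e (y i) = 0.
  apply: big1 => i ik; have -> : Cp_fun e (y i) = 0; last exact: mulr0.
  apply: e0; first by rewrite mem_cat (map_f y) ?orbT ?mem_enum.
  by apply: contra_neq ik => /yi.
by rewrite phiE' (bigD1 k)//= e1 mulr1 rest0 addr0; apply/eqP/b0.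
Qed.

Section point_combination_exists.
Variables (R : realType) (X : topologicalType) (phi : Cp R X -> R).
Hypothesis tX : tychonoff_space X.
Hypothesis phiL : forall a f g, phi (a *: f + g) = a * phi f + phi g.
Hypothesis phiC : continuous phi.

Let phi0 : phi 0 = 0.
Proof.
have /eqP := phiL 1 0 0.
by rewrite scale1r addr0 mul1r addrC -subr_eq subrr eq_sym => /eqP.
Qed.

Let phiZ a f : phi (a *: f) = a * phi f.
Proof. by rewrite -[a *: f]addr0 phiL phi0 addr0. Qed.

Let phiD f g : phi (f + g) = phi f + phi g.
Proof. by rewrite -[f]scale1r phiL mul1r scale1r. Qed.

Let vanishing : set_system (Cp R X) := fun A =>
  exists s : seq X, forall f, (forall x, x \in s -> Cp_fun f x = 0) -> A f.

Let vanishing_filter : Filter vanishing.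
Proof.
split; first by exists [::].
- move=> A B [s sA] [t tB]; exists (s ++ t) => f fst; split.
    by apply: sA => x sx; apply: fst; rewrite mem_cat sx.
  by apply: tB => x sx; apply: fst; rewrite mem_cat sx orbT.
- by move=> A B AB [s sA]; exists s => f /sA /AB.
Qed.

Let vanishing_cvg : vanishing --> (0 : Cp R X).
Proof.
have cvF : (@Cp_fun R X @ vanishing) --> Cp_fun (0 : Cp R X).
  apply/(@pointwise_cvgP X R).
    exact: (@fmap_filter _ _ _ _ vanishing_filter).
  move=> t A; rewrite Cp_fun0 => A0.
  exists [:: t] => f ft /=; rewrite ft ?mem_seq1//.
  exact: nbhs_singleton.
move=> A; rewrite nbhsE => -[_ [[B oB <-] B0] BA].
have : nbhs (Cp_fun (0 : Cp R X)) B by apply: open_nbhs_nbhs.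
by move=> /cvF [s sB]; exists s => f /sB /BA.
Qed.

Let phi_vanish : exists s : seq X, forall f,
  (forall x, x \in s -> Cp_fun f x = 0) -> phi f = 0.
Proof.
have cvphi : phi @ vanishing --> phi 0.
  by move=> A /phiC /vanishing_cvg.
have /cvphi[s sP] := nbhsx_ballx (phi 0) 1 ltr01; exists s => f fs.
apply/eqP; apply: contrapT => /negP f0.
have /sP : forall x, x \in s -> Cp_fun ((phi f)^-1 *: f) x = 0.
  by move=> x /fs fx; rewrite Cp_funZ fx mulr0.
by rewrite /= -ball_normE /= phi0 phiZ mulVf// sub0r normrN normr1 ltxx.
Qed.

Lemma point_combination_exists : exists n (x : 'I_n -> X) (a : 'I_n -> R),
  point_combination phi x a.
Proof.
have [s0 s0P] := phi_vanish; pose s := undup s0.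
have sP f : (forall x, x \in s -> Cp_fun f x = 0) -> phi f = 0.
  by move=> fs; apply: s0P => x sx; apply: fs; rewrite mem_undup.
have us : uniq s by exact: undup_uniq.
have /choice[e eP] := fun z => @tychonoff_bump R X s z tX.
pose c z := phi (e z); pose t := [seq z <- s | c z != 0].
have sumE f : phi f = \sum_(z <- t) c z * Cp_fun f z.
  have phi_sum (r : seq X) g : phi (g - \sum_(z <- r) Cp_fun f z *: e z) =
      phi g - \sum_(z <- r) c z * Cp_fun f z.
    elim: r g => [|z r IH] g; first by rewrite !big_nil !subr0.
    rewrite !big_cons !opprD !addrA IH; congr (_ - _).
    by rewrite -scaleNr phiD phiZ mulNr mulrC.
  have fun_sum (r : seq X) w : Cp_fun (\sum_(z <- r) Cp_fun f z *: e z) w =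
      \sum_(z <- r) Cp_fun f z * Cp_fun (e z) w.
    by elim: r => [|z r IH]; rewrite ?big_nil// !big_cons Cp_funD IH.
  have : phi (f - \sum_(z <- s) Cp_fun f z *: e z) = 0.
    apply: sP => w ws; rewrite Cp_funD Cp_funN fun_sum.
    rewrite (bigD1_seq w)//= (eP w).1 mulr1 big1_seq ?addr0 ?subrr// => z.
    by move=> /andP[zw zs]; rewrite (eP z).2 ?mulr0// eq_sym.
  rewrite phi_sum => /eqP; rewrite subr_eq0 => /eqP ->.
  rewrite /t big_filter [RHS]big_rmcond// => z.
  by rewrite negbK => /eqP ->; rewrite mul0r.
exists (size t), (tnth (in_tuple t)), (fun k => c (tnth (in_tuple t) k)).
split.
- by apply/tuple_uniqP; rewrite /= filter_uniq.
- by move=> k; have := mem_tnth k (in_tuple t); rewrite mem_filter => /andP[].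
- by move=> f; rewrite sumE big_tnth.
Qed.

End point_combination_exists.

Lemma supp_atE (R : realType) (X Y : topologicalType)
    (T : {linear Cp R X -> Cp R Y}) (y : Y) :
  tychonoff_space X -> continuous T ->
  exists n (x : 'I_n -> X) (a : 'I_n -> R),
    point_combination (fun f => Cp_fun (T f) y) x a /\
    supp_at T y = range x.
Proof.
move=> tX cT.
have phiL b f g : Cp_fun (T (b *: f + g)) y =
    b * Cp_fun (T f) y + Cp_fun (T g) y by rewrite linearP.
have phiC : continuous (fun f => Cp_fun (T f) y).
  move=> f; have ev : (fun g : {ptws Y -> R} => g y) @ nbhs (Cp_fun (T f))
      --> Cp_fun (T f) y.
    have FF : Filter (nbhs (Cp_fun (T f))) by exact: nbhs_filter.
    by apply: (@pointwise_cvgP Y R _ (Cp_fun (T f)) FF).1 => A.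
  by move=> A /ev /initial_continuous /cT.
have [n [x [a xa]]] := point_combination_exists tX phiL phiC.
by exists n, x, a; split=> //; exact: supp_rangeE xa.
Qed.

(* Main.v *)
(* The argument gives [dim Y <= p * dim X] unless [X] is empty. The support of
   [y] depends on [y] lower semicontinuously, so the sets of points with support
   of size at most [k] are closed. On a small compact set of points with support
   of size exactly [k] the support is given by [k] continuous functions into [X];
   the map into [X ^ k] they define is finite-to-one, because the functionals
   [f |-> T f y] are linearly independent when [T] has dense range. Hence such a
   compact set has dimension at most [k * dim X]: by Kolmogorov's trick, [X]
   carries [k * dim X + 1] families of small disjoint open sets such that every
   point is missed by at most [dim X] of them, so any [k] points are all met by a
   common family. The countable sum theorem and Dowker's theorem on the
   complement of a closed set then assemble the pieces. *)
Require Import Defs.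
From mathcomp Require Import all_boot all_order all_algebra.
From mathcomp Require Import all_classical all_reals all_analysis.
From mathcomp Require Import lra zify.

Set Implicit Arguments.
Unset Strict Implicit.
Unset Printing Implicit Defensive.

Import Order.TTheory GRing.Theory Num.Theory.
Import numFieldNormedType.Exports.

Local Open Scope classical_set_scope.
Local Open Scope card_scope.
Local Open Scope ring_scope.

(** * Cozero sets in sigma-compact spaces *)

(** If [P K] failed, the sets [A] with [P (K \ A)] would form a proper filter containing [K]. Near a
    cluster point of it in [K], the local hypothesis gives a neighbourhood whose complement belongs
    to the filter, a contradiction. *)
Lemma compact_ind (T : topologicalType) (K : set T) (P : set T -> Prop) :
  compact K -> P set0 -> (forall A B, A `<=` B -> P B -> P A) ->
  (forall A B, P A -> P B -> P (A `|` B)) ->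
  (forall x, K x -> exists2 A, nbhs x A & P (K `&` A)) -> P K.
Proof.
move=> cK P0 Psub PU Ploc; apply: contrapT => nPK.
pose F : set_system T := [set A | P (K `\` A)].
have FF : ProperFilter F.
  apply: Build_ProperFilter.
    by rewrite /F /= setD0.
  split.
  - by rewrite /F /= setDT.
  - by move=> A B FA FB; rewrite /F /= setDIr; exact: PU.
  - by move=> A B AB; apply: Psub; exact: setDS.
have FK : F K by rewrite /F /= setDv.
have [x [Kx clx]] := cK F FF FK; have [A xA PA] := Ploc x Kx.
have FA : F (~` A) by rewrite /F /= setDE setCK.
by have [y [nAy Ay]] := clx _ _ FA xA.
Qed.

Lemma functionally_open_superlevel (R : realType) (T : topologicalType)
    (f g : T -> R) : continuous f -> continuous g ->
  functionally_open R [set x | f x < g x].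
Proof.
move=> cf cg; exists (fun x => Num.max (g x - f x) 0).
  move=> x; apply: (@continuous_max R T (fun x => g x - f x) (fun=> 0)).
    exact: (@continuousB R R T g f x (cg x) (cf x)).
  exact: cvg_cst.
apply/seteqP; split=> x /=; rewrite -subr_gt0.
  by move=> h; rewrite max_l ?gt_eqF// ltW.
by rewrite maxEle; case: ifPn; rewrite ?eqxx// -ltNge.
Qed.

Lemma functionally_open_open (R : realType) (T : topologicalType) (U : set T) :
  functionally_open R U -> open U.
Proof.
move=> [f cf ->].
have -> : [set x | f x != 0] = f @^-1` (~` [set 0]).
  by apply/seteqP; split=> x /= /eqP.
apply: open_comp => [x _|]; first exact: cf.
by rewrite openC; apply: accessible_closed_set1; exact/hausdorff_accessible/Rhausdorff.
Qed.

Lemma open_superlevel (R : realType) (T : topologicalType) (f g : T -> R) :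
  continuous f -> continuous g -> open [set x | f x < g x].
Proof.
by move=> cf cg; apply: (@functionally_open_open R); exact: functionally_open_superlevel.
Qed.

Lemma completely_regular_bump (R : realType) (T : topologicalType) (O : set T)
    (x : T) : completely_regular_space T -> open O -> O x ->
  exists f : T -> R, [/\ continuous f, (forall y, 0 <= f y <= 1), f x = 1 &
    forall y, ~ O y -> f y = 0].
Proof.
move=> crT oO Ox.
have /(@uniform_separatorP _ R)[g [cg g01 g0 g1]] : uniform_separator [set x] (~` O).
  by apply: crT; [exact: open_closedC | exact].
exists (fun y => 1 - g y); split.
- by move=> y; apply: cvgB; [exact: cvg_cst | exact: cg].
- move=> y; have /g01 : range g (g y) by exists y.
  by rewrite /= in_itv /= => /andP[? ?]; apply/andP; split; lra.
- by have -> : g x = 0 by [apply: g0; exists x]; rewrite subr0.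
- by move=> y nOy; have -> : g y = 1 by [apply: g1; exists y]; rewrite subrr.
Qed.

Lemma uniform_approx_continuous (R : realType) (T : topologicalType)
    (g : nat -> T -> R) (e : nat -> R) (f : T -> R) :
  (forall n, continuous (g n)) -> (forall n x, `|f x - g n x| <= e n) ->
  e @ \oo --> (0 : R) -> continuous f.
Proof.
move=> cg fg e0 x; apply/cvgrPdist_lt => d d0.
have d3 : 0 < d / 3 by rewrite divr_gt0.
have [n _ /(_ n (leqnn n)) en] := proj1 (cvgrPdist_lt _ _) e0 _ d3.
have {}en : e n < d / 3 by move: en; rewrite sub0r normrN; exact/le_lt_trans/ler_norm.
have /cvgrPdist_lt/(_ _ d3) := cg n x.
apply: filterS => y gxy.
have fx := fg n x; have := fg n y; rewrite distrC => fy.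
have -> : f x - f y = (f x - g n x) + (g n x - g n y) + (g n y - f y) by lra.
apply: le_lt_trans (ler_normD _ _) _.
apply: le_lt_trans (lerD (ler_normD _ _) (lexx _)) _.
lra.
Qed.

Lemma continuous_sum (R : realType) (T : topologicalType) (I : Type) (r : seq I)
    (P : pred I) (f : I -> T -> R) :
  (forall i, continuous (f i)) -> continuous (fun x => \sum_(i <- r | P i) f i x).
Proof.
move=> cf; elim: r => [|i r IH] x.
  by under eq_fun do rewrite big_nil; exact: cvg_cst.
under eq_fun do rewrite big_cons; rewrite ?big_cons /=; case: (P i); last exact: IH.
by apply: cvgD; [exact: cf | exact: IH].
Qed.

(** The witness is the series of the functions [2 ^- n.+1 * f n], taken as the supremum of its
    partial sums [h]; convergence is uniform with error at most [2 ^- n]. *)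
Lemma countable_joint_support (R : realType) (T : topologicalType)
    (f : nat -> T -> R) :
  (forall n, continuous (f n)) -> (forall n x, 0 <= f n x <= 1) ->
  exists g : T -> R, [/\ continuous g, (forall x, 0 <= g x) &
    forall x, 0 < g x <-> exists n, 0 < f n x].
Proof.
move=> cf f01; pose h n x := \sum_(i < n) 2 ^- i.+1 * f i x.
have e_gt0 i : 0 < 2 ^- i :> R by rewrite invr_gt0 exprn_gt0.
have hS n x : h n.+1 x = h n x + 2 ^- n.+1 * f n x by rewrite /h big_ord_recr.
(* The subtracted [2 ^- (n + k)] is the tail still to come; it makes the induction on [k] close. *)
have hle n k x : h n x <= h (n + k)%N x <= h n x + 2 ^- n - 2 ^- (n + k).
  elim: k => [|k /andP[IH1 IH2]]; first by rewrite addn0; apply/andP; split; lra.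
  have /andP[f0 f1] := f01 (n + k)%N x; rewrite addnS hS.
  have t0 := mulr_ge0 (ltW (e_gt0 (n + k).+1)) f0.
  have := ler_pM (ltW (e_gt0 (n + k).+1)) f0 (lexx _) f1; rewrite mulr1 => t1.
  have e2 : 2 ^- (n + k) = 2 * 2 ^- (n + k).+1 :> R.
    by rewrite exprS invfM mulrA divff ?mul1r // pnatr_eq0.
  by apply/andP; split; lra.
have hub n m x : h m x <= h n x + 2 ^- n.
  have [mn|/ltnW nm] := leqP m n.
    have /andP[+ _] := hle m (n - m)%N x; rewrite subnKC// => /le_trans; apply.
    by rewrite lerDl ltW.
  have /andP[_] := hle n (m - n)%N x; rewrite subnKC// => /le_trans; apply.
  by rewrite gerBl ltW.
have hs x : has_sup (range (h ^~ x)).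
  split; first by exists (h 0%N x), 0%N.
  by exists (h 0%N x + 2 ^- 0) => _ [m _ <-].
pose g x := sup (range (h ^~ x)).
have gl n x : h n x <= g x by apply: sup_upper_bound => //; exists n.
have gu n x : g x <= h n x + 2 ^- n.
  by apply: ge_sup => [|_ [m _ <-]]; [exact: (hs x).1 | exact: hub].
exists g; split.
- apply: (@uniform_approx_continuous _ _ h (fun n => 2 ^- n)).
  + move=> n; apply: continuous_sum => i x.
    by apply: cvgMr; exact: cf.
  + by move=> n x; rewrite ger0_norm ?subr_ge0// lerBlDl.
  + under eq_fun do rewrite -exprVn; apply: cvg_expr.
    by rewrite ger0_norm ?invr_ge0// invf_lt1 ?ltr1n.
- by move=> x; have := gl 0%N x; rewrite /h big_ord0.
- move=> x; split.
    move=> gx0; apply: contrapT => /forallNP f0.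
    suff : g x <= 0 by lra.
    apply: ge_sup => [|_ [m _ <-]]; first exact: (hs x).1.
    rewrite /h big1// => i _; have /negP := f0 i; rewrite -leNgt => fi.
    have /andP[fi0 _] := f01 i x.
    by have -> : f i x = 0 by [lra]; rewrite mulr0.
  move=> [n fn]; apply: lt_le_trans (gl n.+1 x); rewrite hS.
  have /andP[+ _] := hle 0%N n x; rewrite add0n {1}/h big_ord0 => h0.
  have := mulr_gt0 (e_gt0 n.+1) fn; lra.
Qed.

Definition open_cover (T : topologicalType) (s : nat) (U : 'I_s -> set T) :=
  (forall i, open (U i)) /\ forall x, exists i, U i x.

(** On each compact piece finitely many bumps inside the [U i] suffice; for each index, the
    functions obtained from the countably many pieces are then merged into one. *)
Lemma cozero_shrinking (R : realType) (T : topologicalType) (s : nat)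
    (U : 'I_s -> set T) :
  completely_regular_space T -> sigma_compact T -> open_cover U ->
  exists f : 'I_s -> T -> R, [/\ forall i, continuous (f i),
    forall i x, 0 <= f i x, forall i x, 0 < f i x -> U i x &
    forall x, exists i, 0 < f i x].
Proof.
move=> crT [K [cK KT]] [oU covU].
pose good (A : set T) (f : 'I_s -> T -> R) := [/\ forall i, continuous (f i),
    forall i x, 0 <= f i x <= 1, forall i x, 0 < f i x -> U i x &
    forall x, A x -> exists i, 0 < f i x].
have /choice[f fP] : forall n, exists f, good (K n) f.
  move=> n; apply: (@compact_ind _ _ (fun A => exists f, good A f) (cK n)).
  - exists (fun _ _ => 0); split=> //.
    + by move=> i; exact: cst_continuous.
    + by move=> i x; rewrite lexx ler01.
    + by move=> i x; rewrite ltxx.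
  - by move=> A B AB [f [f1 f2 f3 f4]]; exists f; split=> // x /AB; exact: f4.
  - move=> A B [f [f1 f2 f3 f4]] [g [g1 g2 g3 g4]].
    (* Halving keeps the values in [0, 1], as [countable_joint_support] requires. *)
    exists (fun i x => (f i x + g i x) / 2); split.
    + by move=> i x; apply: cvgMl; apply: cvgD; [exact: f1 | exact: g1].
    + move=> i x; have /andP[? ?] := f2 i x; have /andP[? ?] := g2 i x.
      by apply/andP; split; lra.
    + move=> i x fg; have [f0|f0] := ltP 0 (f i x); first exact: f3.
      by apply: g3; lra.
    + move=> x [/f4|/g4] [i fi]; exists i.
        by have /andP[? ?] := g2 i x; lra.
      by have /andP[? ?] := f2 i x; lra.
  - move=> x _; have [i Uix] := covU x.
    have [f [cf f01 fx f0]] := completely_regular_bump R crT (oU i) Uix.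
    exists [set y | 0 < f y].
      apply: open_nbhs_nbhs; split; last by rewrite /= fx ltr01.
      by apply: open_superlevel => //; exact: cst_continuous.
    exists (fun j => if j == i then f else fun=> 0); split.
    + by move=> j; case: eqP => // _; exact: cst_continuous.
    + by move=> j y; case: eqP => // _; rewrite lexx ler01.
    + move=> j y; case: eqP => [->|_]; last by rewrite ltxx.
      by move=> fy; apply: contrapT => /f0 fy0; rewrite fy0 ltxx in fy.
    + by move=> y [_ fy]; exists i; rewrite eqxx.
have /choice[g gP] : forall i, exists g : T -> R,
    [/\ continuous g, (forall x, 0 <= g x) &
        forall x, 0 < g x <-> exists n, 0 < f n i x].
  by move=> i; apply: countable_joint_support => n; have [] := fP n.
exists g; split.
- by move=> i; have [] := gP i.
- by move=> i; have [] := gP i.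
- by move=> i x; have [_ _ ->] := gP i => -[n]; have [_ _ + _] := fP n; exact.
- move=> x; have [n _ Kx] : (\bigcup_n K n) x by rewrite KT.
  have [_ _ _ /(_ x Kx)[i fi]] := fP n.
  by exists i; have [_ _ ->] := gP i; exists n.
Qed.

(** With [f] from [cozero_shrinking], the level [c] is the sum of the [f i] divided by [s + 1]. It
    is positive and strictly below their average, so at each point some [f i] exceeds it; take [V i]
    and [C i] to be the strict and large superlevel sets. *)
Lemma functionally_open_shrinking (R : realType) (T : topologicalType) (s : nat)
    (U : 'I_s -> set T) :
  completely_regular_space T -> sigma_compact T -> open_cover U ->
  exists V C : 'I_s -> set T, [/\ open_cover V,
    forall i, functionally_open R (V i), forall i, closed (C i),
    forall i, V i `<=` C i & forall i, C i `<=` U i].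
Proof.
move=> crT scT oU; have [f [cf f0 fU fx]] := @cozero_shrinking R _ _ _ crT scT oU.
pose c x := s.+1%:R^-1 * \sum_i f i x.
have cc : continuous c by move=> x; apply: cvgMr; apply: continuous_sum.
have cfc i : continuous (fun x => f i x - c x).
  by move=> x; apply: cvgB; [exact: cf | exact: cc].
have c_gt0 x : 0 < c x.
  rewrite /c mulr_gt0 ?invr_gt0// lt_neqAle sumr_ge0// andbT eq_sym.
  rewrite psumr_neq0//; have [i fi] := fx x.
  by apply/hasP; exists i => //; rewrite mem_index_enum.
exists (fun i => [set x | c x < f i x]), (fun i => [set x | c x <= f i x]).
split.
- split=> [i|x].
    by apply: open_superlevel; [exact: cc | exact: cf].
  apply: contrapT => /forallNP ncf.
  have : \sum_i f i x <= \sum_(i < s) c x.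
    by apply: ler_sum => i _; rewrite leNgt; apply/negP/ncf.
  rewrite sumr_const card_ord; have := c_gt0 x.
  have -> : \sum_i f i x = s.+1%:R * c x.
    by rewrite /c mulrA divff ?mul1r ?pnatr_eq0.
  by rewrite -[_ *+ s]mulr_natl mulrSr mulrDl mul1r; lra.
- by move=> i; apply: functionally_open_superlevel; [exact: cc | exact: cf].
- move=> i; rewrite -openC; have -> : ~` [set x | c x <= f i x] = [set x | f i x < c x].
    by apply/seteqP; split=> x /=; rewrite ltNge => /negP.
  by apply: open_superlevel; [exact: cf | exact: cc].
- by move=> i x /= /ltW.
- by move=> i x /= cx; apply: fU; apply: lt_le_trans cx.
Qed.

(** * Covering dimension relative to a subset *)

Definition mult (T : Type) (s : nat) (V : 'I_s -> set T) (x : T) : nat :=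
  #|[pred i | x \in V i]|.

Lemma mult_le (T : Type) (s : nat) (V W : 'I_s -> set T) (x y : T) :
  (forall i, V i x -> W i y) -> (mult V x <= mult W y)%N.
Proof.
move=> VW; apply: subset_leq_card; apply/fintype.subsetP => i.
by rewrite !inE; exact: VW.
Qed.

(** For a set [S] of more than [d] indices, the complements of the [C i] with [i] in [S] cover the
    space. Shrink this cover to closed sets [E S i] and remove these finitely many sets from [U i].
    A point in all [O i] with [i] in [S] would lie in no [E S i]. *)
Lemma open_swelling (R : realType) (T : topologicalType) (s d : nat)
    (C U : 'I_s -> set T) :
  completely_regular_space T -> sigma_compact T ->
  (forall i, closed (C i)) -> (forall i, open (U i)) ->
  (forall i, C i `<=` U i) -> (forall x, (mult C x <= d)%N) ->
  exists O : 'I_s -> set T, [/\ forall i, open (O i), forall i, C i `<=` O i,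
    forall i, O i `<=` U i & forall x, (mult O x <= d)%N].
Proof.
move=> crT scT clC oU CU dC.
have /choice[E EP] : forall S : {set 'I_s}, exists E : 'I_s -> set T,
    (d < #|S|)%N -> [/\ forall i, closed (E i),
      forall i, E i `<=` ~` C i, forall i, i \notin S -> E i = set0 &
      forall x, exists i, E i x].
  move=> S; have [dS|dS] := ltnP d #|S|; last by exists (fun=> set0).
  pose W i := if i \in S then ~` C i else set0.
  have oW : open_cover W.
    split=> [i|x].
      by rewrite /W; case: ifP => _; [rewrite openC | exact: open0].
    apply: contrapT => /forallNP nW.
    have : (#|S| <= mult C x)%N.
      apply: subset_leq_card; apply/fintype.subsetP => i iS; rewrite inE.
      apply: contrapT => nCi; apply: (nW i).
      by rewrite /W iS.
    by rewrite leqNgt (leq_ltn_trans (dC x) dS).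
  have [V [E [[_ cV] _ clE VE EW]]] := functionally_open_shrinking R crT scT oW.
  exists E => _; split=> //.
  - by move=> i x /EW; rewrite /W; case: ifP.
  - by move=> i iS; rewrite -subset0 => x /EW; rewrite /W (negbTE iS).
  - by move=> x; have [i Vi] := cV x; exists i; exact: VE.
pose O i := [set x | U i x /\
  forall S : {set 'I_s}, (d < #|S|)%N && (i \in S) -> ~ E S i x].
exists O; split.
- move=> i; rewrite openE => x [Ux Ex]; apply: filterI.
    exact: open_nbhs_nbhs.
  apply: filter_forall => S; case: (boolP ((d < #|S|)%N && (i \in S))) => dS.
    have /andP[/EP[clE _ _ _] _] := dS.
    have nE : nbhs x (~` E S i).
      by apply: open_nbhs_nbhs; split; [rewrite openC | exact: Ex].
    by apply: filterS nE.
  by apply: nearW.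
- move=> i x Cx; split=> [|S /andP[dS iS] Ex]; first exact: CU.
  by have [_ /(_ _ _ Ex)] := EP S dS.
- by move=> i x [].
- move=> x; rewrite leqNgt; apply/negP => dO.
  pose S := [set i | x \in O i]%SET.
  have dS : (d < #|S|)%N by rewrite cardsE.
  have [_ _ ES cE] := EP S dS; have [i Ex] := cE x.
  have iS : i \in S by apply: contrapT => /negP /ES Ei0; rewrite Ei0 in Ex.
  have := iS; rewrite !inE => -[_ /(_ S)]; rewrite dS iS => /(_ isT).
  exact.
Qed.

(* The order is bounded at the points of [A] only, but the sets are open in, and
   cover, the whole space: this makes unions of such [A] easy to handle. *)
Definition relative_covdim_lt (T : topologicalType) (A : set T) (d : nat) :=
  forall s (U : 'I_s -> set T), open_cover U ->
  exists V : 'I_s -> set T, [/\ open_cover V, forall i, V i `<=` U i &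
    forall x, A x -> (mult V x <= d)%N].

Lemma relative_covdim_lt_sub (T : topologicalType) (A B : set T) (d : nat) :
  A `<=` B -> relative_covdim_lt B d -> relative_covdim_lt A d.
Proof.
by move=> AB dB s U /dB[V [? ? dV]]; exists V; split=> // x /AB; exact: dV.
Qed.

Lemma relative_covdim_lt0 (T : topologicalType) (d : nat) :
  relative_covdim_lt (@set0 T) d.
Proof. by move=> s U oU; exists U; split; [exact: oU | move=> i x | move=> x []]. Qed.

Lemma relative_covdim_ltU (T : topologicalType) (A B : set T) (d : nat) :
  relative_covdim_lt A d -> relative_covdim_lt B d ->
  relative_covdim_lt (A `|` B) d.
Proof.
move=> dA dB s U /dA[V [oV VU dV]]; have [W [oW WV dW]] := dB _ _ oV.
exists W; split=> // [i x /WV /VU//|x [/dV Vx|]]; last exact: dW.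
by apply: leq_trans Vx; apply: mult_le => i; exact: WV.
Qed.

(** Countable sum theorem. Starting from [U], shrink the cover successively so that the closed sets
    [D n i] have order at most [d] on [F n]. The intersections [C i] of the [D n i] over [n] still
    cover, and their order is at most [d] on all of the union; swelling makes them open again. *)
Lemma relative_covdim_lt_bigcup (R : realType) (T : topologicalType)
    (F : nat -> set T) (d : nat) :
  completely_regular_space T -> sigma_compact T -> closed (\bigcup_n F n) ->
  (forall n, relative_covdim_lt (F n) d) -> relative_covdim_lt (\bigcup_n F n) d.
Proof.
move=> crT scT; set A := \bigcup_n F n => clA dF s U oU.
have /choice[next nextP] : forall nV : nat * ('I_s -> set T),
    exists WC : ('I_s -> set T) * ('I_s -> set T), open_cover nV.2 ->
    [/\ open_cover WC.1, forall i, closed (WC.2 i),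
      forall i, WC.1 i `<=` WC.2 i, forall i, WC.2 i `<=` nV.2 i &
      forall x, F nV.1 x -> (mult WC.2 x <= d)%N].
  move=> [n V] /=; have [oV|nV] := pselect (open_cover V); last by exists (V, V).
  have [V' [oV' V'V dV']] := dF n _ _ oV.
  have [W [C [oW _ clC WC CV']]] := functionally_open_shrinking R crT scT oV'.
  exists (W, C) => _; split=> //= [i x /CV' /V'V//|x /dV' V'x].
  by apply: leq_trans V'x; apply: mult_le => i; exact: CV'.
pose V := nat_rect (fun=> 'I_s -> set T) U (fun n W => (next (n, W)).1).
pose D n := (next (n, V n)).2.
have oV n : open_cover (V n).
  by elim: n => [//|n /= oVn]; have [] := nextP (n, V n) oVn.
have DV n i : D n i `<=` V n i by have [_ _ _ + _] := nextP (n, V n) (oV n); exact.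
have VD n i : V n.+1 i `<=` D n i.
  by have [_ _ + _ _] := nextP (n, V n) (oV n); exact.
have Vmono m n i : (m <= n)%N -> V n i `<=` V m i.
  elim: n => [|n IH]; first by rewrite leqn0 => /eqP->.
  rewrite leq_eqVlt => /orP[/eqP->//|]; rewrite ltnS => /IH mn x.
  by move=> /VD /DV /mn.
pose C i := \bigcap_n D n i.
(* If [x] left each [C i] at some stage [N i], it would lie in no set of the cover that comes after
   all of these finitely many stages. *)
have covC x : exists i, C i x.
  apply: contrapT => /forallNP nC.
  have /choice[N NP] : forall i, exists n, ~ D n i x.
    move=> i; apply: contrapT => /forallNP nD; apply: (nC i) => n _.
    by have /contrapT := nD n.
  have [i Vi] := (oV (\max_i N i).+1).2 x.
  apply: (NP i); apply: (VD (N i) i x); apply: Vmono Vi.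
  by rewrite ltnS; exact: leq_bigmax.
have [|||x|O [oO CO OU dO]] := @open_swelling R T s d (fun i => A `&` C i) U crT scT.
- move=> i; apply: closedI => //; apply: closed_bigI => n _.
  by have [_ + _ _ _] := nextP (n, V n) (oV n); exact.
- exact: oU.1.
- by move=> i x [_ /(_ 0%N I) /DV].
- have [[n _ Fx]|nA] := pselect (A x).
    have [_ _ _ _ /(_ x Fx)] := nextP (n, V n) (oV n); apply: leq_trans.
    by apply: mult_le => i [_ /(_ n I)].
  by apply: leq_trans (leq0n d); rewrite leqn0 /mult; apply/eqP/eq_card0 => i;
    rewrite inE; apply/negP; rewrite inE => -[].
(* The order matters on [A] only, so off the closed set [A] the original [U i] restores the
   covering. *)
exists (fun i => O i `|` (U i `\` A)); split.
- split=> [i|x].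
    apply: openU => //; rewrite setDE; apply: openI; first exact: oU.1.
    by rewrite openC.
  have [Ax|nAx] := pselect (A x).
    by have [i Ci] := covC x; exists i; left; apply: CO.
  by have [i Ui] := oU.2 x; exists i; right.
- by move=> i x [/OU|[]].
- by move=> x Ax; apply: leq_trans (dO x); apply: mult_le => i [|[]].
Qed.

(* Dowker's theorem: outside a neighbourhood of [A] the remaining part
   of [A'] lies in a closed set disjoint from [A]. *)
Lemma relative_covdim_lt_closed_off (R : realType) (T : topologicalType)
    (A A' : set T) (d : nat) :
  completely_regular_space T -> sigma_compact T ->
  relative_covdim_lt A d ->
  (forall B, closed B -> B `&` A = set0 -> relative_covdim_lt (A' `&` B) d) ->
  relative_covdim_lt A' d.
Proof.
move=> crT scT dA dB s U oU; have [V [oV VU dV]] := dA _ _ oU.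
have [W [C [oW _ clC WC CV]]] := functionally_open_shrinking R crT scT oV.
(* As the [C i] are closed, their order cannot increase under small moves, so [B] is closed; it
   misses [A] because [C i] lies in [V i]. *)
pose B := [set x | (d < mult C x)%N].
have clB : closed B.
  rewrite -openC openE => x /negP; rewrite -leqNgt => dx.
  have : \forall y \near x, forall i, C i y -> C i x.
    apply: filter_forall => i; have [Cx|nCx] := pselect (C i x).
      exact: nearW.
    have nbC : nbhs x (~` C i) by apply: open_nbhs_nbhs; split => //; rewrite openC.
    by apply: filterS nbC => y.
  apply: filterS => y yx; apply/negP; rewrite -leqNgt.
  exact: leq_trans (mult_le yx) dx.
have BA : B `&` A = set0.
  rewrite -subset0 => x [Bx /dV Vx].
  suff : (mult C x <= d)%N by rewrite leqNgt; apply/negP; rewrite negbK.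
  by apply: leq_trans Vx; apply: mult_le => i; exact: CV.
have [W' [oW' W'W dW']] := dB B clB BA _ _ oW; exists W'; split=> //.
  by move=> i x /W'W /WC /CV /VU.
move=> x A'x; have [Bx|/negP] := pselect (B x); first exact: dW'.
by rewrite -leqNgt; apply: leq_trans; apply: mult_le => i /W'W /WC.
Qed.

(** * Comparison of relative and covering dimension *)

Lemma card_le_seq (T : eqType) (A : set T) (r : seq T) :
  A `<=` [set` r] -> A #<= `I_(size r).
Proof.
case: r => [|x0 r].
  move=> Ar; have -> : A = set0 by rewrite -subset0 => x /Ar.
  by rewrite /= II0; apply/card_le0P.
move=> Ar; apply: card_le_trans (card_image_le (nth x0 (x0 :: r)) _).
by apply: subset_card_le => x /Ar /= /(nthP x0)[i ir <-]; exists i.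
Qed.

Lemma card_ge_seq (T : eqType) (A : set T) (r : seq T) (d : nat) :
  uniq r -> [set` r] `<=` A -> A #<= `I_d -> (size r <= d)%N.
Proof.
case: r => [//|x0 r] ur rA Ad; rewrite -card_le_II.
apply: card_le_trans Ad; apply: card_le_trans (subset_card_le rA).
have <- : nth x0 (x0 :: r) @` `I_(size (x0 :: r)) = [set` x0 :: r].
  apply/seteqP; split=> x /=; first by move=> [i ir <-]; exact: mem_nth.
  by move=> /(nthP x0)[i ir <-]; exists i.
rewrite (card_le_eqr (inj_card_eq _)); first exact: card_lexx.
move=> i j; rewrite !inE => /= ir jr /eqP.
by rewrite nth_uniq// => /eqP.
Qed.

Lemma covdim_lt_relative (R : realType) (T : topologicalType) (d : nat) :
  completely_regular_space T -> sigma_compact T ->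
  relative_covdim_lt (@setT T) d -> covdim_lt R T d.
Proof.
move=> crT scT dT UU [finU oU covU].
have [r Ur] := (finite_seqP _).1 finU.
pose s := size r; pose U (i : 'I_s) := tnth (in_tuple r) i.
have UUi i : UU (U i) by rewrite Ur /=; exact: mem_tnth.
have ocU : open_cover U.
  split=> [i|x]; first exact/functionally_open_open/oU/UUi.
  have [A + Ax] : (\bigcup_(A in UU) A) x by rewrite covU.
  by rewrite Ur /= => /seq_tnthP[i Ai]; exists i; rewrite /U -Ai.
have [V [oV VU dV]] := dT _ _ ocU.
have [W [C [oW foW _ WC CV]]] := functionally_open_shrinking R crT scT oV.
exists (range W); split.
- split.
  + exact: finite_image.
  + by move=> _ [i _ <-].
  + rewrite -subTset => x _; have [i Wi] := oW.2 x.
    by exists (W i) => //; exists i.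
- by move=> _ [i _ <-]; exists (U i) => // x /WC /CV /VU.
- move=> x; have mW : (mult W x <= d)%N.
    by apply: leq_trans (dV x I); apply: mult_le => i /WC /CV.
  pose q := [seq W i | i <- enum [pred i | x \in W i]].
  have qP : [set B | range W B /\ B x] `<=` [set` q].
    move=> _ [[i _ <-] Wx] /=; apply: map_f.
    by rewrite mem_enum inE.
  apply: card_le_trans (card_le_seq qP) _.
  by rewrite size_map -cardE card_le_II.
Qed.

(** * Finite-to-one maps into powers *)

(** Lets covers be built inside the closed set [F]: a relatively open [W i] becomes open once the
    part of [U i] outside [F] is added. *)
Lemma relative_open_shrinking (T : topologicalType) (F : set T) (s d : nat)
    (U W : 'I_s -> set T) :
  closed F -> open_cover U -> (forall i y, W i y -> U i y) ->
  (forall y, F y -> exists i, W i y) ->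
  (forall i y, F y -> W i y -> \forall y' \near y, F y' -> W i y') ->
  (forall y, F y -> (mult W y <= d)%N) ->
  exists V : 'I_s -> set T, [/\ open_cover V, forall i, V i `<=` U i &
    forall x, F x -> (mult V x <= d)%N].
Proof.
move=> clF oU WU covW oW dW.
exists (fun i => [set y | U i y /\ (F y -> W i y)]); split.
- split=> [i|y].
    rewrite openE => y [Uy FW]; apply: filterI.
      by apply: open_nbhs_nbhs; split=> //; exact: oU.1.
    have [Fy|nFy] := pselect (F y); first exact: oW (FW Fy).
    have nF : nbhs y (~` F) by apply: open_nbhs_nbhs; split=> //; rewrite openC.
    by apply: filterS nF.
  have [/covW[i Wi]|nFy] := pselect (F y); first by exists i; split=> //; exact: WU.
  by have [i Ui] := oU.2 y; exists i.
- by move=> i y [].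
- by move=> y Fy; apply: leq_trans (dW y Fy); apply: mult_le => i [_]; exact.
Qed.

Lemma hausdorff_separate_seq (T : topologicalType) (r : seq T) (z : T) :
  hausdorff_space T -> z \notin r ->
  exists A B : set T, [/\ open A, open B, forall x, x \in r -> A x, B z &
    A `&` B = set0].
Proof.
move=> hT; elim: r => [|x r IH].
  move=> _; exists set0, setT; split=> //; [exact: open0|exact: openT|].
  by rewrite set0I.
rewrite inE negb_or => /andP[zx /IH[A [B [oA oB rA Bz AB0]]]].
have := hT; rewrite open_hausdorff => /(_ x z); rewrite eq_sym => /(_ zx).
move=> [[C D] /= [/set_mem Cx /set_mem Dz] [oC oD CD0]].
exists (A `|` C), (B `&` D); split.
- exact: openU.
- exact: openI.
- by move=> y; rewrite inE => /orP[/eqP->|/rA]; [right|left].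
- by split.
- rewrite -subset0 => y [[Ay|Cy] [By Dy]].
    by rewrite -AB0.
  by have /eqP := CD0 => <-.
Qed.

Lemma hausdorff_disjoint_nbhs (T : topologicalType) (r : seq T) :
  hausdorff_space T ->
  exists O : T -> set T, [/\ forall x, open (O x), forall x, x \in r -> O x x &
    forall x y z, x \in r -> y \in r -> O x z -> O y z -> x = y].
Proof.
move=> hT; elim: r => [|z r [N [oN rN dN]]].
  by exists (fun=> set0); split=> // x; exact: open0.
have [zr|zr] := boolP (z \in r).
  have zrE x : (x \in z :: r) = (x \in r).
    by rewrite inE; case: eqVneq => [->|//]; rewrite zr.
  exists N; split=> // [x|x y w]; rewrite !zrE; [exact: rN | exact: dN].
have [A [B [oA oB rA Bz AB0]]] := hausdorff_separate_seq hT zr.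
have AB x : A x -> B x -> False by move=> Ax Bx; have : set0 x by rewrite -AB0.
exists (fun x => if x == z then B else N x `&` A); split.
- by move=> x; case: ifP => // _; exact: openI.
- by move=> x; rewrite inE; case: eqVneq => [->//|_ /= xr]; split; [exact: rN|exact: rA].
- move=> x y w; rewrite !inE; have [->|_] := eqVneq x z; have [->|_] := eqVneq y z.
  + by [].
  + by move=> _ _ Bw [_ /AB].
  + by move=> _ _ [_ /AB].
  + by move=> xr yr [Nx _] [Ny _]; exact: dN Nx Ny.
Qed.

(** Assign to each point of [Z] one index whose set contains it, and let [G i] collect the disjoint
    neighbourhoods of the points with index [i], cut down to [U i]. *)
Lemma hausdorff_disjoint_refinement (T : topologicalType) (s : nat)
    (U : 'I_s -> set T) (Z : set T) :
  hausdorff_space T -> open_cover U -> finite_set Z ->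
  exists G : 'I_s -> set T, [/\ forall i, open (G i), forall i, G i `<=` U i,
    forall i j x, G i x -> G j x -> i = j & forall x, Z x -> exists i, G i x].
Proof.
move=> hT [oU /choice[col colP]] /finite_seqP[r ->].
have [N [oN rN dN]] := hausdorff_disjoint_nbhs r hT.
exists (fun i => \bigcup_(z in [set z | z \in r /\ col z = i]) (N z `&` U i)); split.
- by move=> i; apply: bigcup_open => z _; exact: openI.
- by move=> i x [z _ []].
- by move=> i j x [z [zr <-] [Nz _]] [w [wr <-] [Nw _]]; rewrite (dN z w x).
- by move=> x /= xr; exists (col x); exists x => //; split; [exact: rN | exact: colP].
Qed.

(** The cover is the common refinement of the two-set covers [A i], [B i] for [i] in [r]. *)
Lemma finite_fopen_cover_separating (R : realType) (X : topologicalType)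
    (I : eqType) (r : seq I) (A B : I -> set X) :
  (forall i, functionally_open R (A i)) -> (forall i, functionally_open R (B i)) ->
  (forall i, A i `|` B i = setT) ->
  exists U, finite_fopen_cover R U /\
    forall O i, U O -> i \in r -> O `<=` A i \/ O `<=` B i.
Proof.
move=> foA foB AB.
have foI (C D : set X) : functionally_open R C -> functionally_open R D ->
    functionally_open R (C `&` D).
  move=> [f cf ->] [g cg ->]; exists (fun x => f x * g x).
    by move=> x; apply: cvgM; [exact: cf | exact: cg].
  by apply/seteqP; split=> x /=; rewrite mulf_eq0 negb_or => /andP.
elim: r => [|i r [U [[finU oU covU] Ur]]].
  exists [set setT]; split=> //; split; first exact: finite_set1.
    move=> _ ->; exists (fun=> 1); first exact: cst_continuous.
    by apply/seteqP; split=> x //= _; exact: oner_neq0.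
  by rewrite bigcup_set1.
exists ([set O `&` A i | O in U] `|` [set O `&` B i | O in U]); split.
  split.
  - by rewrite finite_setU; split; exact: finite_image.
  - by move=> _ [] [C /oU oC <-]; exact: foI.
  - rewrite -subTset => x _; have [C UC Cx] : (\bigcup_(C in U) C) x by rewrite covU.
    have [Ax|Bx] : (A i `|` B i) x by rewrite AB.
      by exists (C `&` A i) => //; left; exists C.
    by exists (C `&` B i) => //; right; exists C.
move=> _ j [] [C UC <-]; rewrite inE => /orP[/eqP->|jr].
- by left=> x [].
- by have [OA|OB] := Ur _ _ UC jr; [left=> x [/OA]|right=> x [/OB]].
- by right=> x [].
- by have [OA|OB] := Ur _ _ UC jr; [left=> x [/OA]|right=> x [/OB]].
Qed.

Lemma covdim_lt_separating (R : realType) (X : topologicalType) (m : nat)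
    (I : eqType) (r : seq I) (A B : I -> set X) :
  covdim_lt R X m ->
  (forall i, functionally_open R (A i)) -> (forall i, functionally_open R (B i)) ->
  (forall i, A i `|` B i = setT) ->
  exists n (phi : 'I_n -> X -> R), [/\ forall i, continuous (phi i),
    forall i x, 0 <= phi i x, forall x, exists i, 0 < phi i x,
    forall x, (#|[pred i | (0 < phi i x)%R]| <= m)%N &
    forall i c, c \in r ->
      [set x | 0 < phi i x] `<=` A c \/ [set x | 0 < phi i x] `<=` B c].
Proof.
move=> Xm foA foB AB.
have [U [cU Ur]] := finite_fopen_cover_separating r foA foB AB.
have [V [[finV oV covV] VU mV]] := Xm _ cU.
have [q Vq] := (finite_seqP _).1 finV.
(* Without repetitions, counting indices agrees with counting members of [V]. *)
pose r' := undup q; have Vr O : V O <-> O \in r' by rewrite Vq /= mem_undup.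
pose W (i : 'I_(size r')) := tnth (in_tuple r') i.
have VW i : V (W i) by rewrite Vr; exact: mem_tnth.
have /choice[f fP] : forall i, exists f : X -> R,
    continuous f /\ W i = [set x | f x != 0].
  by move=> i; have [f cf Wf] := oV _ (VW i); exists f.
have WE i x : 0 < `|f i x| <-> W i x by rewrite (fP i).2 normr_gt0.
exists (size r'), (fun i x => `|f i x|); split.
- by move=> i x; apply: cvg_norm; exact: (fP i).1.
- by [].
- move=> x; have [D VD Dx] : (\bigcup_(O in V) O) x by rewrite covV.
  have /seq_tnthP[i Di] := (Vr D).1 VD.
  by exists i; rewrite WE /W -Di.
- move=> x; rewrite cardE -(size_map W); apply: card_ge_seq (mV x).
    rewrite map_inj_uniq ?enum_uniq// => i j; apply/tuple_uniqP.
    by rewrite /= undup_uniq.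
  move=> _ /= /mapP[i + ->]; rewrite mem_enum inE => fi.
  by split=> //; apply/WE.
- move=> i c cr; have [D UD WD] := VU _ (VW i).
  have [DA|DB] := Ur _ _ UD cr; [left|right] => x /= /WE /WD.
    exact: DA.
  exact: DB.
Qed.

(** * Thresholds for Kolmogorov's trick *)

Definition threshold (R : realType) (m t : nat) : R := (m * t.+2)%:R^-1.

(** The largest of at most [m] positive entries is at least a share [1 / m] of the sum. The [t + 2]
    in [threshold] keeps every level strictly below this share, so one index works for all [t]. *)
Lemma large_coordinate (R : realType) (n m : nat) (v : 'I_n -> R) :
  (forall i, 0 <= v i) -> (#|[pred i | (0 < v i)%R]| <= m)%N -> 0 < \sum_i v i ->
  exists i, forall t, threshold R m t * \sum_i v i < v i.
Proof.
move=> v0 vm S0; set S := \sum_i v i in S0 *.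
have m0 : (0 < m)%N.
  rewrite lt0n; apply: contraTneq S0 => mE; rewrite -leNgt /S big1// => i _.
  apply/eqP; rewrite eq_le v0 andbT leNgt; apply/negP => vi.
  by move: vm; rewrite mE leqn0 => /eqP/card0_eq/(_ i); rewrite inE vi.
have m0R : 0 < m%:R :> R by rewrite ltr0n.
have [i vi] : exists i, S <= m%:R * v i.
  apply: contrapT => /forallNP nv.
  have vS i : v i < S / m%:R.
    by rewrite ltr_pdivlMr// mulrC ltNge; apply/negP/nv.
  have [i vi] : exists i, 0 < v i.
    apply: contrapT => /forallNP v_le0; move: S0; rewrite /S big1 ?ltxx// => i _.
    by apply/eqP; rewrite eq_le v0 andbT leNgt; apply/negP/v_le0.
  have SE : S = \sum_(i | 0 < v i) v i.
    rewrite /S (bigID (fun i => 0 < v i)) /= [X in _ + X]big1 ?addr0// => j.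
    by rewrite -leNgt => vj; apply/eqP; rewrite eq_le vj v0.
  have : S < \sum_(i | 0 < v i) S / m%:R.
    rewrite {1}SE; apply: ltr_sum => [|j _]; last exact: vS.
    by apply/hasP; exists i; rewrite ?mem_index_enum.
  rewrite sumr_const -[ltRHS]mulr_natr mulrAC ltr_pdivlMr// ltr_pM2l// ltr_nat ltnNge.
  by rewrite vm.
exists i => t; have S2 : S < 2 * S by rewrite mulr2n mulrDl !mul1r ltrDl.
rewrite /threshold mulrC ltr_pdivrMr ?ltr0n ?muln_gt0 ?m0// natrM.
have vi0 : 0 < m%:R * v i by exact: lt_le_trans vi.
rewrite mulrA [v i * _]mulrC; apply: le_lt_trans vi _.
by rewrite ltr_pMr// ltr1n.
Qed.

(* By [large_coordinate] one of the at most [m] positive entries hits no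
   threshold, and distinct thresholds are hit by distinct entries. *)
Lemma card_threshold_hits (R : realType) (n m N : nat) (v : 'I_n -> R) :
  (forall i, 0 <= v i) -> (#|[pred i | (0 < v i)%R]| <= m)%N -> 0 < \sum_i v i ->
  (#|[pred t : 'I_N | [exists i, (v i == threshold R m t * \sum_i v i)%R]]| <= m.-1)%N.
Proof.
move=> v0 vm S0; have [i0 i0P] := large_coordinate v0 vm S0.
set S := \sum_i v i in S0 i0P *.
have m0 : (0 < m)%N.
  apply: leq_trans vm; apply/card_gt0P; exists i0; rewrite inE.
  by apply: le_lt_trans (i0P 0%N); rewrite mulr_ge0 ?invr_ge0// ltW.
have th_gt0 t : 0 < threshold R m t by rewrite invr_gt0 ltr0n muln_gt0 m0.
set hits := [pred t | _].
have hitP (t : 'I_N) : exists i, t \in hits -> v i = threshold R m t * S.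
  case: (boolP (t \in hits)) => [|_]; last by exists i0.
  by rewrite inE => /existsP[i /eqP vi]; exists i.
have [f fP] := choice hitP.
have finj : {in hits &, injective f}.
  move=> t u th uh ftu; have := fP t th; rewrite ftu (fP u uh) => /mulIf.
  move=> /(_ (lt0r_neq0 S0))/invr_inj/eqP; rewrite eqr_nat eqn_pmul2l//.
  by move=> /eqP[] /ord_inj.
have -> : (m.-1 = m - 1)%N by rewrite subn1.
rewrite leq_subRL// -(card_in_imset finj).
apply: leq_trans vm; rewrite [leqRHS](cardD1 i0) inE.
have -> : 0 < v i0.
  by apply: le_lt_trans (i0P 0%N); rewrite mulr_ge0// ltW.
rewrite leq_add2l; apply: subset_leq_card; apply/fintype.subsetP => i.
move=> /imsetP[t th ->]; rewrite !inE fP// mulr_gt0// andbT.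
by apply: contra_eqN (fP t th) => /eqP ->; rewrite gt_eqF.
Qed.

Section finite_to_one.
Variables (R : realType) (X T : topologicalType) (F : set T) (k : nat).
Variable h : 'I_k -> T -> X.
Hypotheses (crX : completely_regular_space X) (hX : hausdorff_space X).
Hypotheses (hT : hausdorff_space T) (cF : compact F).
Hypothesis ch : forall j y, F y -> h j @ within F (nbhs y) --> h j y.
Hypothesis fib : forall y, F y ->
  finite_set [set y' | F y' /\ forall j, h j y' = h j y].

Let near_h j y (O : set X) : F y -> open O -> O (h j y) ->
  \forall y' \near y, F y' -> O (h j y').
Proof. by move=> Fy oO Oy; apply: (@ch j y Fy O); exact: open_nbhs_nbhs. Qed.

(* Tube lemma: since [F] is compact, a neighbourhood of the fibre contains the
   preimage of a neighbourhood of its image. *)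
Let tube (s : nat) (U : 'I_s -> set T) : open_cover U -> forall y, F y ->
  exists Gg : ('I_s -> set T) * ('I_k -> X -> R),
  [/\ forall i, open (Gg.1 i), forall i, Gg.1 i `<=` U i,
      forall i i' x, Gg.1 i x -> Gg.1 i' x -> i = i' &
      [/\ forall j, continuous (Gg.2 j), forall j, Gg.2 j (h j y) = 0 &
      forall y', F y' -> (forall j, Gg.2 j (h j y') < 1) -> exists i, Gg.1 i y']].
Proof.
move=> oU y Fy; have [G [oG GU dG cG]] := hausdorff_disjoint_refinement hT oU (fib Fy).
pose K := F `&` ~` \bigcup_i G i.
have cK : compact K.
  apply: subclosed_compact cF _; last by move=> ? [].
  apply: closedI; first exact: compact_closed.
  by rewrite closedC; exact: bigcup_open.
(* A point of [K] is outside the fibre of [y], which [G] covers, so some coordinate [h j] separates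
   it from [y]. Compactness leaves finitely many separating functions, which are added up. *)
suff [g [cg g0 g1 gK]] : exists g : 'I_k -> X -> R, [/\ forall j, continuous (g j),
    forall j x, 0 <= g j x, forall j, g j (h j y) = 0 &
    forall y', K y' -> exists j, 1 <= g j (h j y')].
  exists (G, g); split=> //; split=> // y' Fy' gy'; apply: contrapT => nG.
  have [|j] := gK y'; last by rewrite leNgt gy'.
  by split=> // -[i _ Gi]; apply: nG; exists i.
pose P (A : set T) := exists g : 'I_k -> X -> R, [/\ forall j, continuous (g j),
    forall j x, 0 <= g j x, forall j, g j (h j y) = 0 &
    forall y', A y' -> exists j, 1 <= g j (h j y')].
apply: (@compact_ind _ _ P cK).
- by exists (fun _ _ => 0); split=> // j; exact: cst_continuous.
- by move=> A B AB [g [? ? ? gB]]; exists g; split=> // y' /AB; exact: gB.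
- move=> A B [f [cf f0 fy fA]] [g [cg g0 gy gB]].
  exists (fun j x => f j x + g j x); split.
  + by move=> j x; apply: cvgD; [exact: cf | exact: cg].
  + by move=> j x; rewrite addr_ge0.
  + by move=> j; rewrite fy gy addr0.
  + move=> y' [/fA|/gB] [j fj]; exists j; first by rewrite ler_wpDr.
    by rewrite ler_wpDl.
- move=> z [Fz nGz].
  have [j hj] : exists j, h j z <> h j y.
    apply: contrapT => /forallNP hzy; apply: nGz.
    have [|i Gi] := cG z; last by exists i.
    by split=> // j; apply: contrapT; exact: hzy.
  have oy : open (~` [set h j y]).
    by rewrite openC; apply: accessible_closed_set1; exact: hausdorff_accessible.
  have [f [cf f01 fz f0]] := completely_regular_bump R crX oy hj.
  (* The bump is doubled so that the bound 1 is exceeded on a whole neighbourhood of [z]. *)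
  exists [set y' | F y' -> 1 < 2 * f (h j y')].
    apply: (near_h Fz (O := [set x | 1 < 2 * f x])).
      apply: open_superlevel; first exact: cst_continuous.
      by move=> x; apply: cvgMr; exact: cf.
    by rewrite /= fz mulr1 ltr1n.
  exists (fun j' => if j' == j then (fun x => 2 * f x) else fun=> 0); split.
  + move=> j'; case: eqP => _; last exact: cst_continuous.
    by move=> x; apply: cvgMr; exact: cf.
  + by move=> j' x; case: eqP => // _; have /andP[? _] := f01 x; rewrite mulr_ge0.
  + move=> j'; case: eqP => // ->; rewrite f0 ?mulr0//.
    by move=> nn; exact: (nn erefl).
  + by move=> y' [[Fy' _] /(_ Fy') fy']; exists j; rewrite eqxx ltW.
Qed.

(* Kolmogorov's trick. Let [phi] be functions subordinate to a fine cover of [X]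
   of order at most [m]. For each of [k (m - 1) + 1] thresholds, call [y] good if
   no [phi i / S] equals the threshold at any [h j y], and class good points by
   the signs of the differences; the classes are open and disjoint. A point of
   [X] spoils at most [m - 1] thresholds, so each [y] is good for at least one,
   and it lies in one class at most for each threshold. Each class lies in a tube
   of [tube], which cuts it into disjoint pieces subordinate to [U]. *)
Lemma relative_covdim_lt_finite_to_one (m : nat) :
  covdim_lt R X m -> relative_covdim_lt F (k * m.-1).+1.
Proof.
move=> Xm; have [[y0 Fy0]|F0] := pselect (exists y, F y); last first.
  apply: (relative_covdim_lt_sub (B := set0)); last exact: relative_covdim_lt0.
  by move=> y Fy; apply: F0; exists y.
move=> s U oU.
have /choice[D DP] : forall y, exists Gg : ('I_s -> set T) * ('I_k -> X -> R),
    F y -> _ := fun y => match pselect (F y) with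
      | left Fy => let: ex_intro Gg GgP := tube oU Fy in ex_intro _ Gg (fun=> GgP)
      | right nFy => ex_intro _ (U, fun _ _ => 0) (fun Fy => False_ind _ (nFy Fy))
      end.
pose G y := (D y).1; pose g y := (D y).2.
(* The tubes of the finitely many centres in [L] are the regions [g < 1], but [F] is already covered
   by the regions [g < 1/2]; this margin is used in [ex_class]. *)
have [L LF covL] : exists2 L : seq T, (forall y, y \in L -> F y) &
    forall y, F y -> exists2 l, l \in L & forall j, g l j (h j y) < 2^-1.
  apply: (@compact_ind _ _ (fun A => exists2 L : seq T, (forall y, y \in L -> F y) &
    forall y, A y -> exists2 l, l \in L & forall j, g l j (h j y) < 2^-1) cF).
  - by exists [::].
  - by move=> A B AB [L LF LB]; exists L => // y /AB; exact: LB.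
  - move=> A B [L LF LA] [M MF MB]; exists (L ++ M) => y.
      by rewrite mem_cat => /orP[/LF|/MF].
    move=> [/LA|/MB] [l lL gl]; exists l => //; rewrite mem_cat lL//.
    by rewrite orbT.
  - move=> y Fy; have [_ _ _ [cg g0 _]] := DP y Fy.
    exists [set y' | forall j, F y' -> g y j (h j y') < 2^-1].
      apply: filter_forall => j.
      apply: (near_h Fy (O := [set x | g y j x < 2^-1])).
        by apply: open_superlevel; [exact: cg | exact: cst_continuous].
      by rewrite /= [g y j _]g0 invr_gt0.
    exists [:: y] => [y'|y' [Fy' gy']]; first by rewrite mem_seq1 => /eqP->.
    by exists y => [|j]; [rewrite mem_seq1 | exact: gy'].
(* For centres outside [L] the function is 0, so that [A c] is everything and the pair still
   covers. *)
pose A (c : T * 'I_k) := [set x | (if c.1 \in L then g c.1 c.2 else fun=> 0) x < 1].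
pose B (c : T * 'I_k) := [set x | 2^-1 < (if c.1 \in L then g c.1 c.2 else fun=> 0) x].
have cgL (c : T * 'I_k) : continuous (if c.1 \in L then g c.1 c.2 else fun=> 0).
  case: ifP => [/LF/DP[_ _ _ [cg _ _]]|_]; [exact: cg | exact: cst_continuous].
have foA c : functionally_open R (A c).
  by apply: functionally_open_superlevel; [exact: cgL | exact: cst_continuous].
have foB c : functionally_open R (B c).
  by apply: functionally_open_superlevel; [exact: cst_continuous | exact: cgL].
have AB c : A c `|` B c = setT.
  rewrite -subTset => x _; rewrite /A /B /=.
  set v := (X in X < 1); have [v1|v1] := ltP v 1; [by left | right].
  by apply: lt_le_trans v1; rewrite invf_lt1 ?ltr1n.
have [n [phi [cphi phi0 phi_cov phim phiAB]]] :=
  covdim_lt_separating [seq (l, j) | l <- L, j <- enum 'I_k] Xm foA foB AB.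
pose S x := \sum_i phi i x.
have S0 x : 0 < S x.
  have [i fi] := phi_cov x; rewrite lt_neqAle sumr_ge0 // andbT eq_sym psumr_neq0//.
  by apply/hasP; exists i; rewrite ?mem_index_enum.
have cS : continuous S by exact: continuous_sum.
pose th t x := threshold R m t * S x.
have cth t : continuous (th t) by move=> x; apply: cvgMr; exact: cS.
have th_ge0 t x : 0 <= th t x by rewrite mulr_ge0 ?invr_ge0// ltW.
set N := (k * m.-1).+1.
pose good (t : 'I_N) y := forall i j, phi i (h j y) != th t (h j y).
pose same (t : 'I_N) y y' := forall i j,
  (th t (h j y) < phi i (h j y)) = (th t (h j y') < phi i (h j y')).
have ex_good y : exists t, good t y.
  apply: contrapT => /forallNP bad.
  pose hit j (t : 'I_N) := [exists i, phi i (h j y) == th t (h j y)].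
  have : (#|'I_N| <= \sum_(j < k) #|[pred t | hit j t]|)%N.
    rewrite -sum1_card; under [leqRHS]eq_bigr do rewrite -sum1_card big_mkcond.
    rewrite exchange_big /=; apply: leq_sum => t _.
    have [j hj] : exists j, hit j t.
      apply: contrapT => /forallNP nh; apply: (bad t) => i j.
      by apply/negP => e; apply: (nh j); apply/existsP; exists i.
    by rewrite (bigD1 j)//= inE hj.
  rewrite card_ord; apply/negP; rewrite -ltnNge /N ltnS.
  apply: leq_trans (leq_sum _ (fun j _ => card_threshold_hits N _ _ _)) _ => //.
    by move=> j _; exact: S0.
  by rewrite sum_nat_const card_ord.
(* The tube of the centre [l] contains every good point of the class of [y] at threshold [t]. *)
pose near_class t y l := l \in L /\
  forall y', F y' -> good t y' -> same t y y' -> forall j, g l j (h j y') < 1.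
have ex_class t y : F y -> exists l, near_class t y l.
  move=> Fy; have [l lL gl] := covL y Fy; exists l; split=> // y' Fy' gy' yy' j.
  (* This [phi i] is above the threshold at [h j y], hence also at [h j y'], which is in the same
     class. Its support is not inside [B], as [g < 1/2] at [h j y], so it lies in [A]. *)
  have [i iP] := large_coordinate (phi0 ^~ (h j y)) (phim (h j y)) (S0 (h j y)).
  have iy' : 0 < phi i (h j y').
    by apply: le_lt_trans (th_ge0 t (h j y')) _; rewrite -yy'; exact: iP.
  have iy : 0 < phi i (h j y) by apply: le_lt_trans (th_ge0 t (h j y)) _; exact: iP.
  have cr : (l, j) \in [seq (l, j) | l <- L, j <- enum 'I_k].
    by apply/allpairsP; exists (l, j); rewrite mem_enum.
  have [iA|iB] := phiAB i _ cr; first by have := iA _ iy'; rewrite /A /= lL.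
  by have := iB _ iy; rewrite /B /= lL ltNge ltW.
(* Points of one class define the same predicate [near_class], so [xget] chooses the same centre for
   them. *)
pose c t y := xget y0 (near_class t y).
have cP t y : F y -> near_class t y (c t y).
  by move=> /(ex_class t)[l lP]; exact: xgetPex (ex_intro _ l lP).
have c_same t y y' : same t y y' -> c t y = c t y'.
  move=> yy'; rewrite /c; congr xget; apply/funext => l; apply/propext.
  by split=> -[lL lP]; split=> // z Fz gz zz; apply: lP => // i j;
    [rewrite yy' zz | rewrite -yy' zz].
pose W i := [set y | F y /\ exists t, good t y /\ G (c t y) i y].
have clF : closed F by exact: compact_closed.
have GP l : l \in L -> _ := fun lL => DP l (LF l lL).
apply: (relative_open_shrinking (W := W) clF oU).
- move=> i y [Fy [t [_ Gy]]]; have [_ GU _ _] := GP _ (cP t y Fy).1.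
  exact: GU.
- move=> y Fy; have [t gt] := ex_good y.
  have [_ _ _ [_ _ Gcov]] := GP _ (cP t y Fy).1.
  have [|i Gi] := Gcov y Fy; last by exists i; split=> //; exists t.
  by apply: (cP t y Fy).2.
- move=> i y Fy [_ [t [gt Gy]]]; have [oG _ _ _] := GP _ (cP t y Fy).1.
  have near_same : \forall y' \near y, forall ij : 'I_n * 'I_k, F y' ->
      (phi ij.1 (h ij.2 y') != th t (h ij.2 y')) &&
      ((th t (h ij.2 y) < phi ij.1 (h ij.2 y)) ==
       (th t (h ij.2 y') < phi ij.1 (h ij.2 y'))).
    apply: filter_forall => -[i' j] /=; have := gt i' j; rewrite neq_lt => /orP[lt|lt].
      have := near_h Fy (open_superlevel (cphi i') (cth t)) lt.
      apply: filterS => y' H /H /= lt'; rewrite lt_eqF//=.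
      by rewrite !ltNge (ltW lt) (ltW lt').
    have := near_h Fy (open_superlevel (cth t) (cphi i')) lt.
    by apply: filterS => y' H /H /= lt'; rewrite gt_eqF//= lt lt'.
  have nG : nbhs y (G (c t y) i) by apply: open_nbhs_nbhs; split=> //; exact: oG.
  apply: filterS2 nG near_same => y' Gy' H Fy'; split=> //; exists t; split.
    by move=> i' j; have /(_ Fy')/andP[] := H (i', j).
  have <- // : c t y = c t y'.
  by apply: c_same => i' j; have /(_ Fy')/andP[_ /eqP] := H (i', j).
- move=> y Fy.
  (* For a fixed threshold the pieces [G (c t y) i] are disjoint, so an index is recovered from its
     threshold and at most [N] indices occur; [ord0] is a dummy value. *)
  have /choice[tt ttP] : forall i, exists t, W i y -> G (c t y) i y.
    move=> i; have [[_ [t [_ Gt]]]|nW] := pselect (W i y); first by exists t.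
    by exists ord0.
  have <- : #|'I_N| = N by rewrite card_ord.
  rewrite /mult -(card_in_imset (f := tt)); first exact: max_card.
  move=> i i'; rewrite !inE => Wi Wi' tii.
  have [_ _ dG _] := GP _ (cP (tt i) y Fy).1.
  by apply: dG (ttP i Wi) _; rewrite tii; exact: ttP.
Qed.

End finite_to_one.

(** * Supports *)

Lemma near_all_seq (T : topologicalType) (I : eqType) (r : seq I)
    (P : I -> T -> Prop) (y : T) :
  (forall i, i \in r -> \forall y' \near y, P i y') ->
  \forall y' \near y, forall i, i \in r -> P i y'.
Proof.
move=> rP; have : \forall y' \near y, forall j : 'I_(size r), P (tnth (in_tuple r) j) y'.
  by apply: filter_forall => j; apply: rP; exact: mem_tnth.
by apply: filterS => y' H i /seq_tnthP[j ->].
Qed.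

(** * Lower semicontinuous finite supports *)

Section lsc_supports.
Variables (R : realType) (X Y : topologicalType) (sp : Y -> seq X).
Hypotheses (crX : completely_regular_space X) (hX : hausdorff_space X).
Hypotheses (crY : completely_regular_space Y) (hY : hausdorff_space Y).
Hypothesis scY : sigma_compact Y.
Hypothesis sp_uniq : forall y, uniq (sp y).
Hypothesis sp_lsc : forall y x O, x \in sp y -> open O -> O x ->
  \forall y' \near y, exists2 x', x' \in sp y' & O x'.
Hypothesis sp_fib : forall z : seq X, finite_set [set y | perm_eq (sp y) z].

Let near_sp y (N : X -> set X) : (forall x, open (N x)) ->
  (forall x, x \in sp y -> N x x) ->
  \forall y' \near y, forall x, x \in sp y -> exists2 x', x' \in sp y' & N x x'.
Proof.
by move=> oN spN; apply: near_all_seq => x xy; apply: sp_lsc (xy) _ _ => //; exact: spN.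
Qed.

(** Disjoint neighbourhoods of the points of [sp y] all meet [sp y'] for [y'] near [y], so the size
    cannot drop locally. *)
Let closed_sp_le k : closed [set y | (size (sp y) <= k)%N].
Proof.
rewrite -openC openE => y /= /negP; rewrite -ltnNge => ky.
have [N [oN yN dN]] := hausdorff_disjoint_nbhs (sp y) hX.
have := near_sp oN yN; apply: filterS => y' H /=; apply/negP; rewrite -ltnNge.
apply: leq_trans ky _.
have /choice[w wP] : forall x, exists x', x \in sp y -> x' \in sp y' /\ N x x'.
  move=> x; have [/H[x' ? ?]|_] := boolP (x \in sp y); first by exists x'.
  by exists x.
rewrite -(size_map w); apply: uniq_leq_size.
  rewrite map_inj_in_uniq// => x x' xy xy' wx; have [_ Nx] := wP x xy.
  by apply: dN Nx _ => //; rewrite wx; exact: (wP x' xy').2.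
by move=> _ /mapP[x xy ->]; exact: (wP x xy).1.
Qed.

(** Near [y], each of the [k] disjoint neighbourhoods of the points of [sp y] contains exactly one
    of the [k] points of [sp y']. These points are the values [h j y'] to which the finite-to-one
    theorem applies. *)
Let stratum_local (m k : nat) (K : set Y) (y : Y) :
  covdim_lt R X m -> compact K -> (forall y', K y' -> size (sp y') = k) -> K y ->
  exists2 B, nbhs y B & relative_covdim_lt (K `&` B) (k * m.-1).+1.
Proof.
move=> Xm cK Kk Ky.
have [N [oN yN dN]] := hausdorff_disjoint_nbhs (sp y) hX.
have [B yB BN] := @completely_regular_regular R Y crY y _ (near_sp oN yN).
exists B => //; pose F := K `&` closure B.
apply: (@relative_covdim_lt_sub _ _ F).
  by move=> z [Kz Bz]; split=> //; exact: subset_closure.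
have cF : compact F.
  apply: subclosed_compact (cK) _; last by move=> ? [].
  by apply: closedI; [exact: compact_closed | exact: closed_closure].
pose q (j : 'I_k) := tnth (in_tuple (sp y)) (cast_ord (esym (Kk y Ky)) j).
have qy j : q j \in sp y by exact: mem_tnth.
have q_inj : injective q.
  move=> i j /(tuple_uniqP (in_tuple (sp y)) (sp_uniq y)) /(congr1 val) /= ij.
  exact: val_inj.
pose h j y' := xget (q j) [set x | x \in sp y' /\ N (q j) x].
have hP j y' : F y' -> h j y' \in sp y' /\ N (q j) (h j y').
  move=> [_ /BN /(_ (q j) (qy j))[x xy' Nx]].
  pose Q : set X := [set x | x \in sp y' /\ N (q j) x].
  exact: (@xgetPex _ (q j) Q (ex_intro _ x (conj xy' Nx))).
have sp_h y' : F y' -> perm_eq (sp y') [seq h j y' | j <- enum 'I_k].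
  move=> Fy'; have us : uniq [seq h j y' | j <- enum 'I_k].
    rewrite map_inj_uniq ?enum_uniq// => i j hij; apply: q_inj.
    have [_ Ni] := hP i y' Fy'; have [_ Nj] := hP j y' Fy'.
    by apply: dN Ni _ => //; rewrite hij.
  rewrite perm_sym; apply: uniq_perm => //.
  have hs : {subset [seq h j y' | j <- enum 'I_k] <= sp y'}.
    by move=> _ /mapP[j _ ->]; exact: (hP j y' Fy').1.
  apply: (uniq_min_size us hs _).2.
  by rewrite size_map size_enum_ord Kk//; exact: Fy'.1.
apply: (relative_covdim_lt_finite_to_one (h := h) crX hX hY cF) Xm.
(* Semicontinuity yields a point of [sp y'] in the given neighbourhood and in [N (q j)]; by
   disjointness it can only be [h j y']. *)
- move=> j z Fz A; rewrite nbhsE => -[D [oD Dz] DA].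
  have [hz Nz] := hP j z Fz.
  have oI : open (D `&` N (q j)) by exact: openI.
  have := sp_lsc hz oI (conj Dz Nz); apply: filterS => y' [x xy' [Dx Nx]] Fy'.
  apply: DA; have := xy'; rewrite (perm_mem (sp_h y' Fy')) => /mapP[i _ xi].
  suff <- : i = j by rewrite -xi.
  apply: q_inj; have [_ Ni] := hP i y' Fy'.
  by apply: dN Ni _ => //; rewrite -xi.
- move=> z Fz; apply: sub_finite_set (sp_fib [seq h j z | j <- enum 'I_k]).
  move=> y' [Fy' hy'] /=; rewrite (permPl (sp_h y' Fy')).
  by under eq_map do rewrite hy'.
Qed.

(** Induction on the size of supports. A closed set [B] missing the supports of size below [k] meets
    the next stratum in points of size exactly [k]; this closed part is a countable union of compact
    sets, each handled locally. *)
Lemma lsc_support_covdim_lt (m p : nat) : covdim_lt R X m ->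
  (forall y, (size (sp y) <= p)%N) -> covdim_lt R Y (p * m.-1).+1.
Proof.
move=> Xm sp_p; apply: covdim_lt_relative => //.
suff H k : (k <= p.+1)%N ->
    relative_covdim_lt [set y | (size (sp y) < k)%N] (p * m.-1).+1.
  by apply: relative_covdim_lt_sub (H p.+1 (leqnn _)) => y _; exact: sp_p.
elim: k => [|k IH] kp.
  by apply: relative_covdim_lt_sub (@relative_covdim_lt0 Y _) => y.
apply: (@relative_covdim_lt_closed_off R Y _ _ _ crY scY (IH (ltnW kp))) => B clB Bk.
have [K [cK KY]] := scY.
set A := _ `&` B; have clA : closed A by apply: closedI => //; exact: closed_sp_le.
have -> : A = \bigcup_n (A `&` K n) by rewrite -setI_bigcupr KY setIT.
apply: (@relative_covdim_lt_bigcup R) => //.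
  by rewrite -setI_bigcupr KY setIT.
move=> n; have cAK : compact (A `&` K n).
  by rewrite setIC; apply: compact_closedI.
have AKk y : (A `&` K n) y -> size (sp y) = k.
  move=> [[yk By] _]; apply/eqP; rewrite eqn_leq -ltnS yk leqNgt; apply/negP => ky.
  by have : set0 y by rewrite -Bk.
apply: (@compact_ind _ _ (fun A => relative_covdim_lt A (p * m.-1).+1) cAK).
- exact: relative_covdim_lt0.
- by move=> C D; exact: relative_covdim_lt_sub.
- by move=> C D; exact: relative_covdim_ltU.
- move=> y Ay; have [C yC dC] := stratum_local Xm cAK AKk Ay.
  exists C => // s U /dC[V [oV VU dV]]; exists V; split=> // x /dV /leq_trans; apply.
  by rewrite ltnS leq_mul2r -ltnS kp orbT.
Qed.

End lsc_supports.

(** * Linear independence of the functionals given by a map with dense range *)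

Lemma Cp_eval_continuous (R : realType) (Y : topologicalType) (y : Y) :
  continuous (fun g : Cp R Y => Cp_fun g y).
Proof.
move=> g; have ev : (fun g' : {ptws Y -> R} => g' y) @ nbhs (Cp_fun g) --> Cp_fun g y.
  have FF : Filter (nbhs (Cp_fun g)) by exact: nbhs_filter.
  by apply: (@pointwise_cvgP Y R _ (Cp_fun g) FF).1 => A.
by move=> A /ev /initial_continuous.
Qed.

(** The combination [L] of evaluations is continuous and vanishes on the dense range. If [c y] were
    nonzero, a bump at [y] would put a point in the open set where [L] is nonzero. *)
Lemma dense_range_independent (R : realType) (X Y : topologicalType)
    (T : Cp R X -> Cp R Y) (r : seq Y) (c : Y -> R) :
  tychonoff_space Y -> dense (range T) -> uniq r ->
  (forall f, \sum_(y <- r) c y * Cp_fun (T f) y = 0) ->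
  forall y, y \in r -> c y = 0.
Proof.
move=> tY dT ur cT y yr; apply: contrapT => cy.
pose L (g : Cp R Y) := \sum_(y <- r) c y * Cp_fun g y.
have cL : continuous L.
  apply: continuous_sum => y' g; apply: cvgMr; first exact: nbhs_filter.
  exact: (@Cp_eval_continuous R Y y' g).
have oL : open [set g | L g != 0].
  by apply: (@functionally_open_open R); exists L.
have [e [e1 e0]] := @tychonoff_bump R Y r y tY.
have Le : [set g | L g != 0] e.
  rewrite /= /L (bigD1_seq y)//= e1 mulr1 big_seq_cond big1 ?addr0; first exact/eqP.
  by move=> z /andP[zr zy]; rewrite e0 ?mulr0.
have [g [/= /eqP Lg [f _ fg]]] : [set g | L g != 0] `&` range T !=set0.
  by apply: dT => //; exists e.
by apply: Lg; rewrite -fg; exact: cT.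
Qed.

(** More than [size z] functionals in the span of the evaluations on [z] would satisfy a nontrivial
    relation, given by a left kernel vector of the coefficient matrix; independence forbids this. *)
Lemma dense_range_common_support (R : realType) (X Y : topologicalType)
    (T : Cp R X -> Cp R Y) (z : seq X) (r : seq Y) :
  tychonoff_space Y -> dense (range T) -> uniq r ->
  (forall y, y \in r -> exists a : X -> R, forall f,
    Cp_fun (T f) y = \sum_(x <- z) a x * Cp_fun f x) ->
  (size r <= size z)%N.
Proof.
move=> tY dT ur /= rz; rewrite leqNgt; apply/negP => zr.
have /choice[a aP] : forall y, exists a : X -> R, y \in r -> forall f,
    Cp_fun (T f) y = \sum_(x <- z) a x * Cp_fun f x.
  move=> y; have [/rz[a aP]|_] := boolP (y \in r); first by exists a.
  by exists (fun=> 0).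
pose M : 'M[R]_(size r, size z) :=
  \matrix_(i, j) a (tnth (in_tuple r) i) (tnth (in_tuple z) j).
have : kermx M != 0.
  rewrite kermx_eq0; apply/negP => /eqP rM; have := rank_leq_col M.
  by rewrite rM leqNgt zr.
move=> /rowV0Pn[v /sub_kermxP vM /negP[]]; apply/eqP/rowP => i; rewrite mxE.
pose c y := \sum_(i | tnth (in_tuple r) i == y) v 0 i.
have ci j : c (tnth (in_tuple r) j) = v 0 j.
  rewrite /c (big_pred1 j)// => k /=; apply/eqP/eqP => [|->//].
  by apply/tuple_uniqP.
have rr j : tnth (in_tuple r) j \in r by exact: mem_tnth.
rewrite -ci; apply: (dense_range_independent tY dT ur) => [f|]; last exact: mem_tnth.
rewrite big_tnth.
under eq_bigr => j _ do rewrite ci (aP _ (rr j)) big_tnth mulr_sumr.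
rewrite exchange_big /= big1// => j _.
have := congr1 (fun u : 'rV_ _ => u 0 j * Cp_fun f (tnth (in_tuple z) j)) vM.
rewrite !mxE mul0r mulr_suml => {2}<-; apply: eq_bigr => k _.
by rewrite mxE mulrA.
Qed.

Lemma supp_at_seq (R : realType) (X Y : topologicalType)
    (T : {linear Cp R X -> Cp R Y}) (p : nat) (y : Y) :
  tychonoff_space X -> continuous T -> supp_at T y #<= `I_p ->
  exists sc : seq X * (X -> R), [/\ uniq sc.1, (size sc.1 <= p)%N,
    forall x, x \in sc.1 -> sc.2 x != 0 &
    forall f, Cp_fun (T f) y = \sum_(x <- sc.1) sc.2 x * Cp_fun f x].
Proof.
move=> tX cT; have [n [x [a [[x_inj a0 TE] ->]]]] := supp_atE y tX cT.
move=> xp; pose s := [seq x i | i <- enum 'I_n].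
have us : uniq s by rewrite map_inj_uniq ?enum_uniq.
pose c z := \sum_(i | x i == z) a i.
have cx i : c (x i) = a i by rewrite /c (big_pred1 i)// => j; rewrite inj_eq.
exists (s, c); split=> //=.
- by apply: card_ge_seq us _ xp => _ /mapP[i _ ->]; exists i.
- by move=> _ /mapP[i _ ->]; rewrite cx.
- by move=> f; rewrite TE big_map big_enum; apply: eq_bigr => i _; rewrite cx.
Qed.

Theorem theorem3p12 (R : realType) (X Y : topologicalType)
    (tychX : tychonoff_space X) (tychY : tychonoff_space Y)
    (scX : sigma_compact X) (scY : sigma_compact Y)
    (finX : (covdim R X < +oo)%E)
    (T : {linear Cp R X -> Cp R Y}) (contT : continuous T)
    (denseT : dense (range T))
    (p : nat) (p_gt0 : (0 < p)%N)
    (suppT : forall y : Y, supp_at T y #<= `I_p) :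
  (covdim R Y <= p%:Z%:E * covdim R X + p%:Z%:E + p`!%:Z%:E - 1%:E)%E.
Proof.
have [m Xm covX] : exists2 m, covdim_lt R X m & covdim R X = (m%:Z - 1)%:E.
  move: finX; rewrite /covdim; case: pselect => // h _.
  by case: ex_minnP => m /asboolP Xm _; exists m.
have /choice[sc scP] := fun y => supp_at_seq tychX contT (suppT y).
have Ym : covdim_lt R Y (p * m.-1).+1.
  apply: (@lsc_support_covdim_lt R X Y (fun y => (sc y).1)) => //.
  - exact: tychX.1.
  - exact: tychX.2.
  - exact: tychY.1.
  - exact: tychY.2.
  - by move=> y; have [] := scP y.
  - move=> y x O xy oO Ox; have [us _ c0 TE] := scP y.
    (* [O'] isolates [x] from the rest of the support. For a bump [f] in [O'], [T f] is nonzero at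
       [y], hence near [y], which forces the nearby supports to meet [O']. *)
    pose O' := O `&` ~` [set` rem x (sc y).1].
    have oO' : open O'.
      apply: openI => //; rewrite openC.
      apply: (accessible_finite_set_closed.1 (hausdorff_accessible tychX.2)).
      exact: finite_seq.
    have O'x : O' x by split=> //=; rewrite mem_rem_uniqF.
    have [f0 [cf _ fx f0O]] := completely_regular_bump R tychX.1 oO' O'x.
    have [f fE] := Cp_fun_surj cf.
    have Ty : Cp_fun (T f) y != 0.
      rewrite TE (bigD1_seq x)//= fE fx mulr1 big_seq_cond big1 ?addr0 ?c0//.
      move=> z /andP[zy zx]; rewrite fE f0O ?mulr0// => -[_ /=]; apply.
      by rewrite mem_rem_uniq// inE zx.
    have oT : open [set y' | Cp_fun (T f) y' != 0].
      apply: (@functionally_open_open R); exists (Cp_fun (T f)) => //.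
      exact: Cp_fun_continuous.
    have : nbhs y [set y' | Cp_fun (T f) y' != 0] by exact: open_nbhs_nbhs.
    apply: filterS => y' /= /eqP Ty'; apply: contrapT => /forall2NP nO; apply: Ty'.
    have [_ _ _ ->] := scP y'; rewrite big_seq big1// => z zy'.
    rewrite fE f0O ?mulr0// => -[Oz _]; have [] := nO z; exact.
  (* Otherwise [size z + 1] points would share the support [z]. *)
  - move=> z; apply: contrapT => /(infinite_set_fset (size z).+1)[B Bz].
    rewrite leqNgt ltnS => /negP; apply.
    apply: (dense_range_common_support tychY denseT (finmap.fset_uniq B)) => y yB.
    have /= yz := Bz y yB; exists (sc y).2 => f; have [_ _ _ ->] := scP y.
    exact: perm_big.
  - by move=> y; have [] := scP y.
have : (covdim R Y <= ((p * m.-1).+1%:Z - 1)%:E)%E by apply/covdim_leP.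
move=> /le_trans; apply; rewrite covX -!EFinM -!EFinD lee_fin.
(* For [m = 0] the space [X] is empty with dimension -1: the right side is [q - 1], which is at
   least the bound 0 on the left. For larger [m] the left bound is [p] times the dimension of
   [X]. *)
have := fact_gt0 p; set q := p`!; case: m {Xm covX Ym} => [|m] /=; nia.
Qed.
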